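(* Let $\langle F,E\rangle$ be a $w^*$-sequentially complete anti-dual pair and let $A,B\in\mathscr{L}_+(E,F)$ be positive operators. Define $B_0:=B$ and $B_{n+1}:=B_n-B_n:A$ for $n=0,1,2,\dots$, where $:$ denotes the parallel sum. Then the sequence $(B_n)$ has a strong limit $B_s\in\mathscr{L}_+(E,F)$; moreover $B_s$ is $A$-singular (that is, $B_s\perp A$), and $B_a:=B-B_s$ is $A$-absolutely continuous (that is, $B_a\ll A$).
   Context: An anti-dual pair $\langle F,E\rangle$ consists of complex vector spaces $E,F$ and a map $\langle\cdot,\cdot\rangle:F\times E\to\mathbb{C}$, linear in the first and conjugate-linear in the second variable, that separates the points of both $E$ and $F$. It is $w^*$-sequentially complete if for every sequence $(f_n)$ in $F$ such that $(\langle f_n,x\rangle)_n$ is Cauchy for every $x\in E$ there is $f\in F$ with $\langle f_n,x\rangle\to\langle f,x\rangle$ for every $x\in E$. A linear operator $A:E\to F$ is positive if $\langle Ax,x\rangle\ge 0$ for all $x\in E$; $\mathscr{L}_+(E,F)$ is the set of positive operators (they are automatically weakly continuous). For linear operators with real quadratic forms, $S\le T$ means $\langle Sx,x\rangle\le\langle Tx,x\rangle$ for all $x\in E$. For $A,B\in\mathscr{L}_+(E,F)$ the parallel sum $A:B$ is the unique positive operator with $\langle (A:B)x,x\rangle=\inf\{\langle A(x-y),x-y\rangle+\langle By,y\rangle : y\in E\}$ for all $x\in E$; it always exists, is commutative, and satisfies $A:B\le A$, $A:B\le B$ (so each $B_n$ is a positive operator). ''$B_s$ is the strong limit of $(B_n)$''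 means $\langle B_nx,y\rangle\to\langle B_sx,y\rangle$ for all $x,y\in E$, i.e. pointwise convergence in the weak topology $w(F,E)$. $B\ll A$ ($B$ is $A$-absolutely continuous) means: for every sequence $(x_n)$ in $E$, $\langle Ax_n,x_n\rangle\to0$ and $\langle B(x_n-x_m),x_n-x_m\rangle\to0$ (as $n,m\to\infty$) imply $\langle Bx_n,x_n\rangle\to0$. $A\perp B$ (mutual singularity) means: $D\in\mathscr{L}_+(E,F)$, $D\le A$ and $D\le B$ imply $D=0$. *)

(* Defs.v *)
From HB Require Import structures.
From mathcomp Require Import all_boot all_order all_algebra.
From mathcomp Require Import sesquilinear complex.
From mathcomp Require Import boolp classical_sets reals topology normedtype.

Set Implicit Arguments.
Unset Strict Implicit.
Unset Printing Implicit Defensive.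

Import Order.TTheory GRing.Theory Num.Theory.
Import numFieldNormedType.Exports.

Local Open Scope classical_set_scope.
Local Open Scope ring_scope.

(* [R[i]] itself carries no canonical topology; its regular module [R[i]^o]
   has the one induced by the modulus. *)
Notation Cplx R := (R[i]^o).

Record antidual_pair (R : realType) (F E : lmodType R[i]) := AntidualPair {
  pairing :> {bilinear F -> E -> R[i] | *%R & Num.conj \; *%R} ;
  separates_l : forall f g : F,
    (forall x : E, pairing f x = pairing g x) -> f = g ;
  separates_r : forall x y : E,
    (forall f : F, pairing f x = pairing f y) -> x = y }.

Section AntidualPair.
Variables (R : realType) (F E : lmodType R[i]) (P : antidual_pair F E).

Definition wstar_seq_complete : Prop :=
  forall f : nat -> F,
    (forall x : E, cauchy ((fun n => P (f n) x : Cplx R) @ \oo)) ->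
    exists g : F, forall x : E,
      (fun n => P (f n) x : Cplx R) @ \oo --> (P g x : Cplx R).

(* The order of [R[i]] relates only numbers with the same imaginary part: here
   [0 <= z] says that [z] is real and nonnegative. *)
Definition positive_op (A : {linear E -> F}) : Prop :=
  forall x : E, 0 <= P (A x) x.

Definition le_op (S T : {linear E -> F}) : Prop :=
  forall x : E, P (S x) x <= P (T x) x.

Definition sub_op (S T : {linear E -> F}) : {linear E -> F} := S \- T.

(* For positive [A] and [B] the numbers under the infimum are real, so [Re]
   only changes their type from [R[i]] to [R]. *)
Definition is_parallel_sum (A B S : {linear E -> F}) : Prop :=
  positive_op S /\
  forall x : E, P (S x) x =
    (inf [set complex.Re (P (A (x - y)) (x - y) + P (B y) y)
         | y in [set: E]])%:C%C.

(* The junk value [\0] is taken only if no operator satisfies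
   [is_parallel_sum]. *)
Definition parallel_sum (A B : {linear E -> F}) : {linear E -> F} :=
  match pselect (exists S, is_parallel_sum A B S) with
  | left exS => projT1 (cid exS)
  | right _ => \0
  end.

Fixpoint parallel_seq (A B : {linear E -> F}) (n : nat) : {linear E -> F} :=
  if n is m.+1 then
    sub_op (parallel_seq A B m) (parallel_sum (parallel_seq A B m) A)
  else B.

Definition strong_limit (T : nat -> {linear E -> F}) (S : {linear E -> F}) :
    Prop :=
  forall x y : E,
    (fun n => P (T n x) y : Cplx R) @ \oo --> (P (S x) y : Cplx R).

Definition abs_continuous (B A : {linear E -> F}) : Prop :=
  forall u : nat -> E,
    (fun n => P (A (u n)) (u n) : Cplx R) @ \oo --> (0 : Cplx R) ->
    (fun nm => P (B (u nm.1 - u nm.2)) (u nm.1 - u nm.2) : Cplx R)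
      @ (\oo, \oo) --> (0 : Cplx R) ->
    (fun n => P (B (u n)) (u n) : Cplx R) @ \oo --> (0 : Cplx R).

Definition singular_op (A B : {linear E -> F}) : Prop :=
  forall D : {linear E -> F},
    positive_op D -> le_op D A -> le_op D B -> forall x : E, D x = 0.

End AntidualPair.

(* Main.v *)
From HB Require Import structures.
Require Import Defs.
From mathcomp Require Import all_boot all_order all_algebra.
From mathcomp Require Import sesquilinear complex.
From mathcomp Require Import boolp classical_sets reals topology normedtype.
From mathcomp Require Import sequences ring lra.

(** The parallel sum [B_n : A] is positive and lies below [B_n], so the [B_n]
    remain positive and their quadratic forms decrease.  By polarization all the
    forms [<B_n x, y>] converge, and sequential completeness turns the limits
    into an operator [Bs] ([decreasing_strong_limit]).

    Singularity.  The infimum defining the quadratic form of [S : A] is monotone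
    in [S], so the form of [Bs : A] lies below that of [B_n : A], which is
    [<B_n x, x> - <B_(n+1) x, x>] and tends to 0 ([energy_inf_limit]).  A
    positive operator [D] below both [Bs] and [A] satisfies [D <= 2 (Bs : A)]
    ([common_minorant_le]), because [<D x, x>] is at most
    [2 <D (x - y), x - y> + 2 <D y, y>]; hence [D = 0].

    Absolute continuity.  Each [B_k : A] lies below [A], so [B - B_m <= m A]
    ([partial_sum_dominated]): the partial sums of the decreasing sequence are
    dominated by multiples of [A], and they increase to [B - Bs].  If [u] is
    [A]-null and Cauchy for [B - Bs], then
    [<(B - B_m) u_n, u_n>] is at most
    [2 <(B - Bs) (u_n - u_k), u_n - u_k> + 2 m <A u_k, u_k>]
    ([partial_sum_split]).  Letting first [k] and then [m] tend to infinity
    bounds [<(B - Bs) u_n, u_n>] by the Cauchy error.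

    Most of the work is the existence of the parallel sum
    ([parallel_sum_ex]).  For fixed [x], take [u] minimizing the energy
    [<A (x - y), x - y> + <B y, y>] up to [1 / (n + 1)].  A discriminant
    argument shows that the Euler-Lagrange residual
    [<B u_n, w> - <A (x - u_n), w>] is bounded, in the dual of the seminorm of
    [A + B], by a quantity tending to 0 ([residual_sqr_le]).  Consequently [u]
    is Cauchy for [A + B], the functionals [B u_n] converge weakly, and
    completeness gives a limit [S x] in [F].  The residual bound is stable under
    linear combinations and forces the limit 0 when [x = 0], hence [S] is
    linear.

    All estimates are made on the real part [rp] of the pairing: since
    [Im <f, x> = Re <f, i x>], convergence and equality of the real parts at
    every vector give convergence and equality of the pairings. *)

Set Implicit Arguments.
Unset Strict Implicit.
Unset Printing Implicit Defensive.

Import Order.TTheory GRing.Theory Num.Theory.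
Import numFieldNormedType.Exports.

Local Open Scope classical_set_scope.
Local Open Scope ring_scope.

(** * Real sequences *)

Section RealSequences.
Variable R : realType.
Implicit Types (a b c K : R) (s : nat -> R).

(** Evaluate at the minimum [- b / c] if [0 < c], and otherwise where the
    polynomial would be negative. *)
Lemma discriminant_le a b c :
  (forall t, 0 <= a + 2 * t * b + t ^+ 2 * c) -> b ^+ 2 <= a * c.
Proof.
move=> nneg; have a_ge0 : 0 <= a by have := nneg 0; nra.
have [c_gt0|c_le0] := ltP 0 c.
  have := nneg (- (b / c)).
  have -> : a + 2 * (- (b / c)) * b + (- (b / c)) ^+ 2 * c =
      (a * c - b ^+ 2) / c.
    by field; rewrite gt_eqF.
  by rewrite pmulr_lge0 ?invr_gt0// subr_ge0.
have [b0|b_neq0] := eqVneq b 0.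
  have [c0|c_neq0] := eqVneq c 0; first by rewrite b0 c0; nra.
  have c_lt0 : c < 0 by rewrite lt_neqAle c_neq0.
  (* For [b = 0] and [c < 0], this makes [a + t ^ 2 c] at most [-1]. *)
  have := nneg ((a + 1) / - c + 1).
  rewrite b0; set t := _ / _ => h.
  have : t * - c = a + 1 by rewrite /t; field; lra.
  have : 0 <= t by apply: divr_ge0; lra.
  nra.
(* The linear part [a + 2 t b] equals [-1] there, and [c <= 0]. *)
have := nneg (- ((a + 1) / (2 * b))).
set t := _ / _ => h.
have : t * (2 * b) = a + 1 by rewrite /t; field.
have := sqr_ge0 t.
nra.
Qed.

(** Bounds by [K / (n + 1)] on squares avoid taking square roots of the
    Cauchy-Schwarz estimates below. *)
Lemma cvg0_sqr_harmonic K s :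
  (forall n, s n ^+ 2 <= K * harmonic n) -> s @ \oo --> (0 : R).
Proof.
move=> sK; apply/cvgrPdist_le => e e_gt0.
have : (fun n => K * harmonic n) @ \oo --> K * 0.
  by apply: cvgMr; exact: cvg_harmonic.
rewrite mulr0 => /cvgrPdist_le /(_ (e ^+ 2)); rewrite exprn_gt0// => /(_ isT).
apply: filterS => n; rewrite !sub0r !normrN => Kn.
rewrite -ler_sqr ?nnegrE ?normr_ge0 ?(ltW e_gt0)// real_normK ?num_real//.
exact: le_trans (sK n) (le_trans (ler_norm _) Kn).
Qed.

Lemma cvg_sqr_harmonic K s :
  (forall m n, (m <= n)%N -> (s n - s m) ^+ 2 <= K * harmonic m) ->
  cvg (s @ \oo).
Proof.
move=> sK; apply/cauchy_cvgP/cauchy_exP => e e_gt0.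
have : (fun n => K * harmonic n) @ \oo --> K * 0.
  by apply: cvgMr; exact: cvg_harmonic.
have e2_gt0 : 0 < (e / 2) ^+ 2 by rewrite exprn_gt0// divr_gt0.
rewrite mulr0 => /cvgrPdist_le /(_ _ e2_gt0) [N _ KN].
exists (s N); exists N => // n /= Nn; rewrite -ball_normE /ball_/=.
apply: (@le_lt_trans _ _ (e / 2)); last by lra.
rewrite -ler_sqr ?nnegrE ?normr_ge0//; last by lra.
rewrite real_normK ?num_real// -sqrrN opprB.
apply: le_trans (sK _ _ Nn) _.
have := KN N (leqnn _); rewrite /= sub0r normrN.
by apply: le_trans; exact: ler_norm.
Qed.

Lemma cvg_real_unique s a b : s @ \oo --> a -> s @ \oo --> b -> a = b.
Proof. by apply: cvg_unique; exact: norm_hausdorff. Qed.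

End RealSequences.

(** * Convergence of complex numbers *)

Section ComplexTopology.
Variable R : realType.

Lemma conjCE (z : R[i]) : Num.conj z = conjc z.
Proof. by []. Qed.

Lemma normr_ReIm_le (z : R[i]) :
  `|z| <= (`|complex.Re z| + `|complex.Im z|)%:C%C.
Proof.
rewrite {1}(complexE z).
apply: le_trans (ler_normD _ _) _.
rewrite normrM rmorphD/= !normc_def/=.
by rewrite !expr0n/= !addr0 !add0r expr1n sqrtr1 mul1r !sqrtr_sqr.
Qed.

Lemma normr_Re_le (z : R[i]) : `|complex.Re z|%:C%C <= `|z|.
Proof.
by rewrite normc_def lecR -sqrtr_sqr ler_wsqrtr// lerDl sqr_ge0.
Qed.

Lemma cvg_complex T (G : set_system T) {FG : Filter G}
    (f : T -> R[i]) (l : R[i]) :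
  (fun t => complex.Re (f t)) @ G --> complex.Re l ->
  (fun t => complex.Im (f t)) @ G --> complex.Im l ->
  (f : T -> Cplx R) @ G --> (l : Cplx R).
Proof.
move=> /cvgrPdist_le fRe /cvgrPdist_le fIm; apply/cvgrPdist_le => e e_gt0.
have [er e_real] : exists er : R, e = er%:C%C.
  by apply/complex_realP/gtr0_real.
move: e_gt0; rewrite e_real ltcR => er_gt0.
have er2_gt0 : 0 < er / 2 by lra.
have := fIm _ er2_gt0; apply: filterS2 (fRe _ er2_gt0) => t hRe hIm.
apply: le_trans (normr_ReIm_le _) _.
by rewrite lecR !raddfB/=; lra.
Qed.

Lemma cvg_Re T (G : set_system T) {FG : Filter G}
    (f : T -> R[i]) (l : R[i]) :
  (f : T -> Cplx R) @ G --> (l : Cplx R) ->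
  (fun t => complex.Re (f t)) @ G --> complex.Re l.
Proof.
move=> /cvgrPdist_le fl; apply/cvgrPdist_le => e e_gt0.
have : 0 < e%:C%C by rewrite ltcR.
move=> /fl; apply: filterS => t ft.
by rewrite -lecR -raddfB; apply: le_trans (normr_Re_le _) ft.
Qed.

End ComplexTopology.

(** * The real part of the pairing *)

Section RealPairing.
Variables (R : realType) (F E : lmodType R[i]) (P : antidual_pair F E).

(** Real-valued, so that estimates on it are within reach of real arithmetic;
    by [Im_pairing] it determines the pairing. *)
Definition rp (f : F) (x : E) : R := complex.Re (P f x).

Lemma rpDl f g x : rp (f + g) x = rp f x + rp g x.
Proof. by rewrite /rp linearDl raddfD. Qed.

Lemma rpBl f g x : rp (f - g) x = rp f x - rp g x.
Proof. by rewrite /rp linearBl raddfB. Qed.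

Lemma rpDr f x y : rp f (x + y) = rp f x + rp f y.
Proof. by rewrite /rp linearDr raddfD. Qed.

Lemma rpBr f x y : rp f (x - y) = rp f x - rp f y.
Proof. by rewrite /rp linearBr raddfB. Qed.

Lemma rpNl f x : rp (- f) x = - rp f x.
Proof. by rewrite /rp linearNl raddfN. Qed.

Lemma rpNr f x : rp f (- x) = - rp f x.
Proof. by rewrite /rp linearNr raddfN. Qed.

Lemma rp0l x : rp 0 x = 0.
Proof. by rewrite /rp linear0l. Qed.

Lemma rp0r f : rp f 0 = 0.
Proof. by rewrite /rp linear0r. Qed.

Lemma rpZl c f x : rp (c *: f) x = rp f (conjc c *: x).
Proof. by rewrite /rp linearZl_LR linearZr_LR/= conjCE conjcK. Qed.

Lemma rpZrr (t : R) f x : rp f (t%:C%C *: x) = t * rp f x.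
Proof.
rewrite /rp linearZr_LR/= conjCE conjc_real.
by case: (P f x) => a b /=; rewrite mul0r subr0.
Qed.

Lemma rpZlr (t : R) f x : rp (t%:C%C *: f) x = t * rp f x.
Proof. by rewrite rpZl conjc_real rpZrr. Qed.

Definition rpE := (rpNl, rpNr, rpDl, rpDr, rpZlr, rpZrr).

Lemma Im_pairing f x : complex.Im (P f x) = rp f ('i%C *: x).
Proof.
rewrite /rp linearZr_LR/= conjCE.
by case: (P f x) => a b /=; rewrite !mul0r sub0r mulN1r opprK.
Qed.

Lemma rp_inj f g : (forall x, rp f x = rp g x) -> f = g.
Proof.
move=> fg; apply: (separates_l (a := P)) => x.
by apply/eqP; rewrite eq_complex !Im_pairing -/(rp f x) -/(rp g x) !fg !eqxx.
Qed.

Lemma rp_cvg_pairing (f : nat -> F) g :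
  (forall x, (fun n => rp (f n) x) @ \oo --> rp g x) ->
  forall x, (fun n => P (f n) x : Cplx R) @ \oo --> (P g x : Cplx R).
Proof.
move=> fg x; apply: cvg_complex; first exact: fg.
by under eq_fun do rewrite Im_pairing; rewrite Im_pairing; exact: fg.
Qed.

Lemma pairing_cvg_rp (f : nat -> F) g x :
  (fun n => P (f n) x : Cplx R) @ \oo --> (P g x : Cplx R) ->
  (fun n => rp (f n) x) @ \oo --> rp g x.
Proof. exact: cvg_Re. Qed.

(** Sequential completeness for [rp]: the imaginary parts converge because they
    are real parts at the vectors [i x]. *)
Lemma wstar_limit (f : nat -> F) : wstar_seq_complete P ->
  (forall x, cvg ((fun n => rp (f n) x) @ \oo)) ->
  exists g, forall x, (fun n => rp (f n) x) @ \oo --> rp g x.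
Proof.
move=> complete fcvg.
have [|g fg] := complete f.
  move=> x; apply: cvg_cauchy.
  pose l := Complex (lim ((fun n => rp (f n) x) @ \oo))
                    (lim ((fun n => rp (f n) ('i%C *: x)) @ \oo)).
  apply: (cvgP (l : Cplx R)).
  apply: cvg_complex; first exact: fcvg.
  by under eq_fun do rewrite Im_pairing; exact: fcvg.
by exists g => x; exact: pairing_cvg_rp.
Qed.

Lemma linear_map_ex (f : E -> F) :
  linear f -> exists S : {linear E -> F}, f = S.
Proof.
move=> lin_f.
pose aux := GRing.isLinear.Build R[i] E F *:%R f lin_f.
pose S : {linear E -> F} := HB.pack f aux.
by exists S.
Qed.

Section PositiveOperator.
Variable T : {linear E -> F}.
Hypothesis posT : positive_op P T.

Lemma rp_ge0 x : 0 <= rp (T x) x.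
Proof. by have := posT x; rewrite lecE => /andP[]. Qed.

Lemma rp_i_eq0 x : rp (T x) ('i%C *: x) = 0.
Proof. by rewrite -Im_pairing; exact: ger0_Im. Qed.

(** Polarization at [x + i y]: the imaginary part of the quadratic form vanishes
    there, and its cross terms are the two sides. *)
Lemma rp_sym x y : rp (T x) y = rp (T y) x.
Proof.
have := rp_i_eq0 (x + 'i%C *: y).
rewrite scalerDr linearD !(rpDl, rpDr) !rp_i_eq0 add0r addr0.
rewrite scalerA -expr2 sqr_i scaleN1r linearZ/= !rpZl.
rewrite scalerA; have -> : conjc 'i%C * 'i%C = 1 :> R[i] by simpc.
rewrite scale1r.
by rewrite -[- y]add0r rpBr rp0r; lra.
Qed.

(** The discriminant of the quadratic form along the line [x + t y]. *)
Lemma CauchySchwarz x y :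
  rp (T x) y ^+ 2 <= rp (T x) x * rp (T y) y.
Proof.
apply: discriminant_le => t.
have := rp_ge0 (x + t%:C%C *: y).
rewrite linearD linearZ !(rpDl, rpDr) rpZlr !rpZrr rpZlr (rp_sym y x).
lra.
Qed.

Lemma rpZZ c x : rp (T (c *: x)) (c *: x) =
  (complex.Re c ^+ 2 + complex.Im c ^+ 2) * rp (T x) x.
Proof.
rewrite linearZ/= rpZl scalerA -rpZrr; congr (rp _ (_ *: _)).
by case: c => a b; simpc; rewrite !expr2; congr Complex; ring.
Qed.

End PositiveOperator.

(** The second condition says that the quadratic form is real. *)
Lemma positive_opP (T : {linear E -> F}) :
  (forall x, 0 <= rp (T x) x) -> (forall x, rp (T x) ('i%C *: x) = 0) ->
  positive_op P T.
Proof. by move=> re im x; rewrite lecE Im_pairing im eqxx re. Qed.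

Lemma le_opP (S T : {linear E -> F}) :
  positive_op P S -> positive_op P T ->
  (forall x, rp (S x) x <= rp (T x) x) <-> le_op P S T.
Proof.
move=> posS posT; split=> ST x; last by have := ST x; rewrite lecE => /andP[].
by rewrite lecE !Im_pairing !rp_i_eq0// eqxx ST.
Qed.

End RealPairing.

(** * Existence of the parallel sum *)

Section ParallelSum.
Variables (R : realType) (F E : lmodType R[i]) (P : antidual_pair F E).
Variables (A B : {linear E -> F}).
Hypotheses (posA : positive_op P A) (posB : positive_op P B).
Local Notation rp := (rp P).

Definition gram (w : E) : R := rp (A w) w + rp (B w) w.

Definition energy (x y : E) : R := rp (A (x - y)) (x - y) + rp (B y) y.

(** Half the derivative at [u] of [energy x] in the direction [w]; see
    [energyD]. *)
Definition residual (x u w : E) : R := rp (B u) w - rp (A (x - u)) w.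

(** The residual is small in the dual of the [A + B] seminorm.  For minimizing
    sequences [K = 1] works; unlike exact minimization at rate [1 / (n + 1)],
    this property is linear in the pair [(x, u)]. *)
Definition near_minimizing (x : E) (u : nat -> E) : Prop :=
  exists2 K, 0 <= K &
    forall n w, residual x (u n) w ^+ 2 <= K * harmonic n * gram w.

Lemma gram_ge0 w : 0 <= gram w.
Proof. by rewrite addr_ge0// rp_ge0. Qed.

Lemma energy_ge0 x y : 0 <= energy x y.
Proof. by rewrite addr_ge0// rp_ge0. Qed.

Lemma energyD x u (t : R) w : energy x (u + t%:C%C *: w) =
  energy x u + 2 * t * residual x u w + t ^+ 2 * gram w.
Proof.
rewrite /energy /residual /gram opprD addrA; move: (x - u) => v.
have -> : A (v - t%:C%C *: w) = A v - t%:C%C *: A w by rewrite linearB linearZ.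
have -> : B (u + t%:C%C *: w) = B u + t%:C%C *: B w by rewrite linearD linearZ.
rewrite !rpE.
by rewrite (rp_sym posA w v) (rp_sym posB w u); ring.
Qed.

(** The polynomial [t |-> energy x (u + t w) - energy x u + e] is nonnegative,
    so its discriminant is nonpositive. *)
Lemma residual_sqr_le x u e :
  (forall y, energy x u <= energy x y + e) ->
  forall w, residual x u w ^+ 2 <= e * gram w.
Proof.
move=> min_u w; apply: discriminant_le => t.
by have := min_u (u + t%:C%C *: w); rewrite energyD; lra.
Qed.

Lemma gram_le_energy x u : gram (x - u) <= 2 * energy x u + 2 * rp (B x) x.
Proof.
have := rp_ge0 posB (x + u); rewrite /gram /energy.
have -> : B (x + u) = B x + B u by rewrite linearD.
have -> : B (x - u) = B x - B u by rewrite linearB.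
have := rp_ge0 posA (x - u).
rewrite !rpE (rp_sym posB u x); lra.
Qed.

Lemma residualP c x y u v w :
  residual (c *: x + y) (c *: u + v) w =
  residual x u (conjc c *: w) + residual y v w.
Proof.
rewrite /residual.
have -> : c *: x + y - (c *: u + v) = c *: (x - u) + (y - v).
  by rewrite opprD addrACA scalerBr.
by rewrite !linearP !rpDl !rpZl; ring.
Qed.

Lemma gramZ c w :
  gram (c *: w) = (complex.Re c ^+ 2 + complex.Im c ^+ 2) * gram w.
Proof. by rewrite /gram !rpZZ// mulrDr. Qed.

Lemma near_minimizing_linear c x y u v :
  near_minimizing x u -> near_minimizing y v ->
  near_minimizing (c *: x + y) (fun n => c *: u n + v n).
Proof.
move=> [K K_ge0 uK] [L L_ge0 vL].
exists (2 * (K * (complex.Re (conjc c) ^+ 2 + complex.Im (conjc c) ^+ 2) + L)).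
  by rewrite mulr_ge0 ?addr_ge0 ?mulr_ge0 ?addr_ge0 ?sqr_ge0.
move=> n w; rewrite residualP.
have := uK n (conjc c *: w); have := vL n w; rewrite gramZ.
set r := residual _ _ _; set s := residual _ _ _.
have := sqr_ge0 (r - s).
lra.
Qed.

(** For [x = 0] the residual is the form of [A + B]; test its dual bound at [d]
    itself. *)
Lemma gram_residual0_le d e : 0 <= e ->
  (forall w, residual 0 d w ^+ 2 <= e * gram w) -> gram d <= e.
Proof.
move=> e_ge0 /(_ d); have -> : residual 0 d d = gram d.
  by rewrite /residual /gram sub0r linearN rpNl opprK addrC.
have := gram_ge0 d; rewrite le_eqVlt => /predU1P[<-//|d_gt0].
by rewrite expr2 ler_pM2r.
Qed.

(** The residual of [u n - u m] at 0 is the difference of two small residuals at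
    [x], so [gram_residual0_le] applies to it. *)
Lemma near_minimizing_cauchy x u : near_minimizing x u ->
  exists K, forall m n, (m <= n)%N -> gram (u n - u m) <= K * harmonic m.
Proof.
move=> [K K_ge0 uK]; exists (4 * K) => m n mn.
have hm_ge0 : 0 <= harmonic m :> R by exact: harmonic_ge0.
apply: gram_residual0_le => [|w]; first by rewrite !mulr_ge0.
have -> : residual 0 (u n - u m) w = residual x (u n) w - residual x (u m) w.
  rewrite /residual sub0r opprB.
  have -> : u m - u n = (x - u n) - (x - u m)
    by rewrite opprB [RHS]addrC subrKA.
  move: (x - u n) (x - u m) => a b.
  by rewrite (linearB B) (linearB A) !rpE; ring.
have := uK n w; have := uK m w.
have hnm : harmonic n <= harmonic m :> R.
  by rewrite /harmonic/= lef_pV2 ?posrE ?ltr0n// ler_nat ltnS.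
have : (K * gram w) * harmonic n <= (K * gram w) * harmonic m.
  by rewrite ler_wpM2l// mulr_ge0// gram_ge0.
have := sqr_ge0 (residual x (u n) w + residual x (u m) w).
lra.
Qed.

Lemma rp_sqr_le_gram d z : rp (B d) z ^+ 2 <= gram d * rp (B z) z.
Proof.
apply: le_trans (CauchySchwarz posB d z) _.
by rewrite ler_wpM2r ?(rp_ge0 posB)// lerDr (rp_ge0 posA).
Qed.

Lemma near_minimizing_cvg x u z : near_minimizing x u ->
  cvg ((fun n => rp (B (u n)) z) @ \oo).
Proof.
move=> /near_minimizing_cauchy[K uK].
apply: (@cvg_sqr_harmonic _ (K * rp (B z) z)) => m n mn.
rewrite -rpBl -linearB mulrAC.
apply: le_trans (rp_sqr_le_gram _ _) _.
by rewrite ler_wpM2r ?(rp_ge0 posB)// uK.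
Qed.

(** Uniqueness of the weak limit of [B u_n], the source of linearity in [x]. *)
Lemma near_minimizing0_cvg u z : near_minimizing 0 u ->
  (fun n => rp (B (u n)) z) @ \oo --> (0 : R).
Proof.
move=> [K K_ge0 uK].
apply: (@cvg0_sqr_harmonic _ (K * rp (B z) z)) => n.
rewrite mulrAC; apply: le_trans (rp_sqr_le_gram _ _) _.
rewrite ler_wpM2r ?(rp_ge0 posB)// gram_residual0_le ?mulr_ge0//.
exact: harmonic_ge0.
Qed.

Definition energy_inf (x : E) : R := inf [set energy x y | y in [set: E]].

Lemma energy_inf_le x y : energy_inf x <= energy x y.
Proof.
apply: ge_inf; last by exists y.
by exists 0 => _ [z _ <-]; exact: energy_ge0.
Qed.

Lemma energy_infP x : has_inf [set energy x y | y in [set: E]].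
Proof.
split; first by exists (energy x 0); exists 0.
by exists 0 => _ [z _ <-]; exact: energy_ge0.
Qed.

Lemma minimizing_sequence x : exists u : nat -> E, forall n,
  energy x (u n) <= energy_inf x + harmonic n.
Proof.
suff /choice[u uP] : forall n, exists y,
    energy x y <= energy_inf x + harmonic n.
  by exists u.
move=> n; have h_gt0 : 0 < harmonic n :> R by exact: harmonic_gt0.
have [_ [y _ <-] /ltW] := inf_adherent h_gt0 (energy_infP x).
by exists y.
Qed.

Section MinimizingSequence.
Variables (x : E) (u : nat -> E).
Hypothesis min_u : forall n, energy x (u n) <= energy_inf x + harmonic n.

Lemma minimizing_residual n w :
  residual x (u n) w ^+ 2 <= harmonic n * gram w.
Proof.
apply: residual_sqr_le => y; apply: le_trans (min_u n) _.
by rewrite lerD2r energy_inf_le.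
Qed.

Lemma minimizing_near_minimizing : near_minimizing x u.
Proof. by exists 1 => // n w; rewrite mul1r minimizing_residual. Qed.

(** The test vector varies with [n], but its seminorm stays bounded because the
    energies do.  With [c = 1] this identifies the limit of [Re <B u_n, x>],
    with [c = i] that of the imaginary part. *)
Lemma minimizing_residual_cvg c :
  (fun n => residual x (u n) (c *: (x - u n))) @ \oo --> (0 : R).
Proof.
apply: (@cvg0_sqr_harmonic _ ((complex.Re c ^+ 2 + complex.Im c ^+ 2) *
  (2 * (energy_inf x + 1) + 2 * rp (B x) x))) => n.
apply: le_trans (minimizing_residual n _) _.
rewrite mulrC ler_wpM2r ?harmonic_ge0// gramZ ler_wpM2l ?addr_ge0 ?sqr_ge0//.
apply: le_trans (gram_le_energy _ _) _; rewrite lerD2r ler_wpM2l//.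
apply: le_trans (min_u n) _; rewrite lerD2l.
by rewrite /harmonic/= invf_le1 ?ler1n ?ltr0n.
Qed.

Lemma minimizing_energy_cvg :
  (fun n => energy x (u n)) @ \oo --> energy_inf x.
Proof.
apply: (@squeeze_cvgr _ _ _ _ (fun=> energy_inf x)
  (fun n => energy_inf x + harmonic n)).
- by apply: nearW => n; rewrite energy_inf_le min_u.
- exact: cvg_cst.
- rewrite -[X in _ --> X]addr0; apply: cvgD; first exact: cvg_cst.
  exact: cvg_harmonic.
Qed.

Lemma minimizing_cvg : (fun n => rp (B (u n)) x) @ \oo --> energy_inf x.
Proof.
rewrite -[energy_inf x]addr0.
have eqB n : rp (B (u n)) x =
    energy x (u n) + residual x (u n) (1 *: (x - u n)).
  by rewrite scale1r /energy /residual !rpBr; ring.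
under eq_fun do rewrite eqB.
by apply: cvgD; [exact: minimizing_energy_cvg|exact: minimizing_residual_cvg].
Qed.

Lemma minimizing_cvg_i :
  (fun n => rp (B (u n)) ('i%C *: x)) @ \oo --> (0 : R).
Proof.
have eqB n : rp (B (u n)) ('i%C *: x) = residual x (u n) ('i%C *: (x - u n)).
  by rewrite /residual (rp_i_eq0 posA) scalerBr rpBr (rp_i_eq0 posB) !subr0.
by under eq_fun do rewrite eqB; exact: minimizing_residual_cvg.
Qed.

End MinimizingSequence.

Lemma is_parallel_sumP S : is_parallel_sum P A B S <->
  positive_op P S /\ forall x, rp (S x) x = energy_inf x.
Proof.
have infE x : inf [set complex.Re (P (A (x - y)) (x - y) + P (B y) y)
    | y in [set: E]] = energy_inf x.
  by congr inf; apply: eq_imagel => y _; rewrite raddfD.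
split=> -[posS qS]; split=> // x.
  by have /(congr1 (@complex.Re R)) := qS x; rewrite infE.
apply/eqP; rewrite eq_complex Im_pairing (rp_i_eq0 posS) eqxx andbT /=.
by rewrite -/(rp (S x) x) qS infE.
Qed.

(** The operator sends [x] to the weak limit of [B u_n] for a minimizing
    sequence [u] of [energy x]. *)
Lemma parallel_sum_ex : wstar_seq_complete P ->
  exists S, is_parallel_sum P A B S.
Proof.
move=> complete.
have /choice[ug ugP] : forall x, exists ug : (nat -> E) * F,
    (forall n, energy x (ug.1 n) <= energy_inf x + harmonic n) /\
    forall z, (fun n => rp (B (ug.1 n)) z) @ \oo --> rp ug.2 z.
  move=> x; have [u min_u] := minimizing_sequence x.
  have [g ug] : exists g, forall z, (fun n => rp (B (u n)) z) @ \oo --> rp g z.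
    apply: wstar_limit => // z; apply: near_minimizing_cvg.
    exact: minimizing_near_minimizing min_u.
  by exists (u, g).
pose f x := (ug x).2; pose u x := (ug x).1.
have min_u x := (ugP x).1; have u_cvg x := (ugP x).2.
have [S fS] : exists S : {linear E -> F}, f = S.
  apply: linear_map_ex => c x y; apply: (rp_inj (P := P)) => z.
  (* Two candidates at [c x + y]; their difference is near-minimizing at 0. *)
  pose v n := (c *: u x n + u y n) - u (c *: x + y) n.
  have v0 : near_minimizing 0 v.
    rewrite -[0](subrr (c *: x + y)) -[_ - _]addrC -scaleN1r.
    rewrite (_ : v = fun n => (-1) *: u (c *: x + y) n + (c *: u x n + u y n)).
      apply: near_minimizing_linear; last apply: near_minimizing_linear;
        exact: minimizing_near_minimizing (min_u _).
    by apply/funext => n; rewrite /v addrC scaleN1r.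
  have cvg1 := near_minimizing0_cvg z v0.
  have : rp (f x) (conjc c *: z) + rp (f y) z - rp (f (c *: x + y)) z = 0.
    apply: cvg_real_unique cvg1.
    have eqv n : rp (B (v n)) z = rp (B (u x n)) (conjc c *: z) +
        rp (B (u y n)) z - rp (B (u (c *: x + y) n)) z.
      by rewrite /v linearB linearD linearZ/= !rpE rpZl.
    under eq_fun do rewrite eqv.
    by apply: cvgB (u_cvg _ _); apply: cvgD; exact: u_cvg.
  by rewrite rpDl rpZl; lra.
have SE x z : (fun n => rp (B (u x n)) z) @ \oo --> rp (S x) z.
  by rewrite -fS; exact: u_cvg.
have qS x : rp (S x) x = energy_inf x.
  by apply: cvg_real_unique (SE x x) _; exact: minimizing_cvg (min_u x).
exists S; apply/is_parallel_sumP; split=> //; apply: positive_opP => x.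
  rewrite qS; apply: lb_le_inf; first by exists (energy x 0); exists 0.
  by move=> _ [y _ <-]; exact: energy_ge0.
by apply: cvg_real_unique (SE x _) _; exact: minimizing_cvg_i (min_u x).
Qed.

End ParallelSum.

(** * Order properties and monotone limits of positive operators *)

Section OperatorOrder.
Variables (R : realType) (F E : lmodType R[i]) (P : antidual_pair F E).
Implicit Types S T A B D : {linear E -> F}.
Local Notation rp := (rp P).

Lemma rp_sub S T x y : rp (sub_op S T x) y = rp (S x) y - rp (T x) y.
Proof. exact: rpBl. Qed.

Lemma positive_sub S T : positive_op P S -> positive_op P T ->
  (forall x, rp (T x) x <= rp (S x) x) -> positive_op P (sub_op S T).
Proof.
move=> posS posT TS; apply: positive_opP => x; rewrite rp_sub ?subr_ge0//.
by rewrite !rp_i_eq0// subrr.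
Qed.

Lemma rp_triangle T x y : positive_op P T ->
  rp (T x) x <= 2 * rp (T (x - y)) (x - y) + 2 * rp (T y) y.
Proof.
move=> posT; have := rp_ge0 posT (x - y - y).
have -> : T x = T (x - y) + T y by rewrite -linearD subrK.
rewrite -{4}(subrK y x); move: (x - y) => z.
by rewrite linearB !rpE (rp_sym posT y z); lra.
Qed.

Lemma positive_op_eq0 T : positive_op P T ->
  (forall x, rp (T x) x <= 0) -> forall x, T x = 0.
Proof.
move=> posT T0 x; apply: (rp_inj (P := P)) => y; rewrite rp0l.
have qx0 : rp (T x) x = 0 by apply/le_anti; rewrite T0 rp_ge0.
have := CauchySchwarz posT x y; rewrite qx0 mul0r => h.
by apply/eqP; rewrite -sqrf_eq0 eq_le h sqr_ge0.
Qed.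

Lemma parallel_sum_spec A B : wstar_seq_complete P ->
  positive_op P A -> positive_op P B ->
  positive_op P (parallel_sum P A B) /\
  forall x, rp (parallel_sum P A B x) x = energy_inf P A B x.
Proof.
move=> complete posA posB; apply/is_parallel_sumP => //.
rewrite /parallel_sum; case: pselect => [exS|[]]; first by case: cid.
exact: parallel_sum_ex.
Qed.

Lemma energy_inf_le_l A B x : positive_op P A -> positive_op P B ->
  energy_inf P A B x <= rp (A x) x.
Proof.
move=> posA posB; apply: le_trans (energy_inf_le posA posB x 0) _.
by rewrite /energy subr0 rp0r addr0.
Qed.

Lemma energy_inf_le_r A B x : positive_op P A -> positive_op P B ->
  energy_inf P A B x <= rp (B x) x.
Proof.
move=> posA posB; apply: le_trans (energy_inf_le posA posB x x) _.
by rewrite /energy subrr rp0r add0r.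
Qed.

Lemma energy_inf_ge A B x (a : R) :
  (forall y, a <= energy P A B x y) -> a <= energy_inf P A B x.
Proof.
move=> lb; apply: lb_le_inf; first by exists (energy P A B x 0); exists 0.
by move=> _ [y _ <-].
Qed.

Lemma energy_inf_monol S T A x : positive_op P S -> positive_op P T ->
  positive_op P A -> (forall y, rp (S y) y <= rp (T y) y) ->
  energy_inf P S A x <= energy_inf P T A x.
Proof.
move=> posS posT posA ST; apply: energy_inf_ge => y.
by apply: le_trans (energy_inf_le posS posA x y) _; rewrite lerD2r.
Qed.

(** By [rp_triangle], half of [D] is below every energy: this is the bound
    [D : D <= A : B], where [D : D] is half of [D]. *)
Lemma common_minorant_le D A B x : positive_op P D ->
  (forall y, rp (D y) y <= rp (A y) y) ->
  (forall y, rp (D y) y <= rp (B y) y) ->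
  rp (D x) x <= 2 * energy_inf P A B x.
Proof.
move=> posD DA DB; rewrite -ler_pdivrMl//; apply: energy_inf_ge => y.
rewrite /energy; have := rp_triangle x y posD.
by have := DA (x - y); have := DB y; lra.
Qed.

(** Quadratic forms decrease, hence converge; polarization extends this to all
    matrix entries, and completeness provides the values of the limit. *)
Lemma decreasing_strong_limit (T : nat -> {linear E -> F}) :
  wstar_seq_complete P -> (forall n, positive_op P (T n)) ->
  (forall n x, rp (T n.+1 x) x <= rp (T n x) x) ->
  exists S : {linear E -> F},
    [/\ positive_op P S,
        forall x y, (fun n => rp (T n x) y) @ \oo --> rp (S x) y &
        forall n x, rp (S x) x <= rp (T n x) x].
Proof.
move=> complete posT decT.
have niT x : nonincreasing_seq (fun n => rp (T n x) x).
  by apply/nonincreasing_seqP => n; exact: decT.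
have qcvg x : cvg ((fun n => rp (T n x) x) @ \oo).
  apply: nonincreasing_is_cvgn => //.
  by exists 0 => _ [n _ <-]; exact: rp_ge0.
have bcvg x y : cvg ((fun n => rp (T n x) y) @ \oo).
  have polar n : rp (T n x) y =
      2^-1 * (rp (T n (x + y)) (x + y) - rp (T n x) x - rp (T n y) y).
    by rewrite linearD !rpE (rp_sym (posT n) y x); field.
  under eq_fun do rewrite polar.
  by apply: is_cvgMr; apply: is_cvgB; [apply: is_cvgB|]; exact: qcvg.
have /choice[f fT] : forall x, exists g,
    forall y, (fun n => rp (T n x) y) @ \oo --> rp g y.
  by move=> x; exact: wstar_limit (bcvg x).
have [S fS] : exists S : {linear E -> F}, f = S.
  apply: linear_map_ex => c x y; apply: (rp_inj (P := P)) => z.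
  apply: (cvg_real_unique (fT _ _)).
  have TE n : rp (T n (c *: x + y)) z =
      rp (T n x) (conjc c *: z) + rp (T n y) z.
    by rewrite linearP rpDl rpZl.
  under eq_fun do rewrite TE.
  by rewrite rpDl rpZl; apply: cvgD; exact: fT.
have TS x y : (fun n => rp (T n x) y) @ \oo --> rp (S x) y.
  by rewrite -fS; exact: fT.
exists S; split=> //; last first.
  move=> n x; rewrite -(cvg_lim (@Rhausdorff R) (TS x x)).
  exact: nonincreasing_cvgn_ge.
apply: positive_opP => x.
  rewrite -(cvg_lim (@Rhausdorff R) (TS x x)).
  by apply: limr_ge => //; apply: nearW => n; exact: rp_ge0.
apply: cvg_real_unique (TS _ _) _.
by under eq_fun do rewrite rp_i_eq0//; exact: cvg_cst.
Qed.

End OperatorOrder.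

(** * The Lebesgue-type decomposition *)

Section LebesgueDecomposition.
Variables (R : realType) (F E : lmodType R[i]) (P : antidual_pair F E).
Variables (A B : {linear E -> F}).
Hypothesis complete : wstar_seq_complete P.
Hypotheses (posA : positive_op P A) (posB : positive_op P B).
Local Notation rp := (rp P).
Local Notation T := (parallel_seq P A B).

Lemma parallel_seq_positive n : positive_op P (T n).
Proof.
elim: n => //= n posT; have [posp pE] := parallel_sum_spec complete posT posA.
by apply: positive_sub => // x; rewrite pE energy_inf_le_l.
Qed.

Lemma parallel_seqS n x :
  rp (T n.+1 x) x = rp (T n x) x - energy_inf P (T n) A x.
Proof.
rewrite /= rp_sub; congr (_ - _).
by have [] := parallel_sum_spec complete (parallel_seq_positive n) posA.
Qed.

Lemma energy_inf_parallel_seq_ge0 n x : 0 <= energy_inf P (T n) A x.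
Proof.
apply: energy_inf_ge => y; apply: energy_ge0 => //.
exact: parallel_seq_positive.
Qed.

Lemma parallel_seq_decr n x : rp (T n.+1 x) x <= rp (T n x) x.
Proof. by rewrite parallel_seqS gerBl energy_inf_parallel_seq_ge0. Qed.

Lemma parallel_seq_le n x : rp (T n x) x <= rp (B x) x.
Proof. by elim: n => // n; exact/le_trans/parallel_seq_decr. Qed.

(** [B - T n] is the sum of [n] parallel sums with [A], each of them below
    [A]. *)
Lemma partial_sum_dominated n x :
  rp (B x) x - rp (T n x) x <= n%:R * rp (A x) x.
Proof.
elim: n => [|n IHn]; first by rewrite subrr mul0r.
have := energy_inf_le_r x (parallel_seq_positive n) posA.
by rewrite parallel_seqS mulrS mulrDl mul1r; lra.
Qed.

Variable Bs : {linear E -> F}.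
Hypothesis posBs : positive_op P Bs.
Hypothesis Bs_cvg :
  forall x, (fun n => rp (T n x) x) @ \oo --> rp (Bs x) x.
Hypothesis Bs_le : forall n x, rp (Bs x) x <= rp (T n x) x.

(** [Bs : A] is below each [T n : A = T n - T (n + 1)], which tends to 0. *)
Lemma energy_inf_limit x : energy_inf P Bs A x <= 0.
Proof.
have diff0 : (fun n => rp (T n x) x - rp (T n.+1 x) x) @ \oo --> (0 : R).
  rewrite -(subrr (rp (Bs x) x)); apply: cvgB => //.
  by have := @Bs_cvg x; rewrite -(cvg_shiftS (fun n => rp (T n x) x)).
rewrite -(cvg_lim (@Rhausdorff R) diff0).
apply: limr_ge; first exact: cvgP diff0.
apply: nearW => n; rewrite parallel_seqS subKr.
by apply: energy_inf_monol => //; exact: parallel_seq_positive.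
Qed.

Lemma limit_singular : singular_op P Bs A.
Proof.
move=> D posD /(le_opP posD posBs) DBs /(le_opP posD posA) DA.
apply: (positive_op_eq0 posD) => x.
have := common_minorant_le x posD DBs DA; have := energy_inf_limit x; lra.
Qed.

Lemma ac_part_positive : positive_op P (sub_op B Bs).
Proof. by apply: positive_sub => //; exact: (Bs_le 0). Qed.

(** Split [a = (a - b) + b] in the form of [B - T m], which is below [B - Bs]
    and below [m A]. *)
Lemma partial_sum_split a b m :
  rp (B a) a - rp (T m a) a <=
  2 * rp (sub_op B Bs (a - b)) (a - b) + 2 * (m%:R * rp (A b) b).
Proof.
have posBT : positive_op P (sub_op B (T m)).
  by apply: positive_sub => // x;
    [exact: parallel_seq_positive|exact: parallel_seq_le].
have := rp_triangle a b posBT; have := partial_sum_dominated m b.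
have := Bs_le m (a - b).
by rewrite !rp_sub; lra.
Qed.

Lemma ac_part_abs_continuous : abs_continuous P (sub_op B Bs) A.
Proof.
move=> u /cvg_Re Au0 /cvg_Re uu0.
apply: cvg_complex; last first.
  under eq_fun do rewrite Im_pairing (rp_i_eq0 ac_part_positive).
  exact: cvg_cst.
apply/cvgrPdist_le => e e_gt0.
have e2_gt0 : 0 < e / 2 by lra.
move/cvgrPdist_le : uu0 => /(_ _ e2_gt0).
move=> [[Q1 Q2] /= [[N1 _ Q1N] [N2 _ Q2N]] Qsub].
exists (maxn N1 N2) => // n /=; rewrite geq_max => /andP[N1n N2n].
rewrite sub0r normrN ger0_norm ?(rp_ge0 ac_part_positive)//.
rewrite -/(rp _ _) rp_sub.
have BT_cvg : (fun m => rp (B (u n)) (u n) - rp (T m (u n)) (u n)) @ \oo -->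
    rp (B (u n)) (u n) - rp (Bs (u n)) (u n).
  by apply: cvgB => //; exact: cvg_cst.
rewrite -(cvg_lim (@Rhausdorff R) BT_cvg).
apply: limr_le; first exact: cvgP BT_cvg.
apply: nearW => m.
(* The bound of [partial_sum_split] at [b = u k], as [k] tends to infinity. *)
have bound_cvg : (fun k => e + 2 * (m%:R * rp (A (u k)) (u k))) @ \oo --> e.
  rewrite -[X in _ --> X]addr0; apply: cvgD; first exact: cvg_cst.
  rewrite -[X in _ --> X](mulr0 2); apply: cvgMr.
  by rewrite -[X in _ --> X](mulr0 m%:R); apply: cvgMr.
rewrite -(cvg_lim (@Rhausdorff R) bound_cvg).
apply: limr_ge; first exact: cvgP bound_cvg.
exists N2 => // k /= N2k.
apply: le_trans (partial_sum_split (u n) (u k) m) _; rewrite lerD2r.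
have := Qsub (n, k) (conj (Q1N _ N1n) (Q2N _ N2k)).
rewrite /= sub0r normrN ger0_norm ?(rp_ge0 ac_part_positive)//.
by rewrite /rp; lra.
Qed.

End LebesgueDecomposition.

Theorem proposition3p1 (R : realType) (F E : lmodType R[i])
    (P : antidual_pair F E) (A B : {linear E -> F}) :
  wstar_seq_complete P ->
  positive_op P A -> positive_op P B ->
  exists Bs : {linear E -> F},
    [/\ positive_op P Bs,
        strong_limit P (parallel_seq P A B) Bs,
        singular_op P Bs A,
        positive_op P (sub_op B Bs) &
        abs_continuous P (sub_op B Bs) A].
Proof.
move=> complete posA posB.
have [Bs [posBs Bs_cvg Bs_le]] := decreasing_strong_limit complete
  (parallel_seq_positive complete posA posB)
  (parallel_seq_decr complete posA posB).
exists Bs; split=> //.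
- by move=> x; apply: rp_cvg_pairing => y; exact: Bs_cvg.
- exact: limit_singular posBs (fun x => Bs_cvg x x) Bs_le.
- exact: ac_part_positive Bs_le.
- exact: ac_part_abs_continuous (fun x => Bs_cvg x x) Bs_le.
Qed.
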